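(* Let $U,b$ be strictly positive rationals and $\mu\in(0,U]_{\mathcal Q}$. If the initial inventory is $x_0=U$ and $\frac{\mu}{U}<\frac{1}{b+1}$, then $$\lim_{T\to\infty}\frac{\inf_{\pi\in\Pi}\sup_{Q\in\mathbf{MAR}_T}\mathbb E_Q\big[\sum_{t=1}^TC^\pi_t\big]}{\inf_{\pi\in\Pi}\sup_{Q\in\mathbf{IND}_T}\mathbb E_Q\big[\sum_{t=1}^TC^\pi_t\big]}=\frac{U-\mu}{b\mu}>1.$$
   Context: $[0,U]_{\mathcal Q}=[0,U]\cap\mathbb Q$, $(0,U]_{\mathcal Q}=(0,U]\cap\mathbb Q$; $z_+=\max(z,0)$; $C(x,d)=b(d-x)_++(x-d)_+$. For a vector $\mathbf d$, $\mathbf d_{[s]}=(d_1,\dots,d_s)$ ($\mathbf d_{[0]}$ is empty). For horizon $T\ge1$, an admissible policy $\pi$ is a vector $(x^\pi_1,\dots,x^\pi_T)$ where $x_1^\pi$ is a rational constant with $x_1^\pi\ge x_0$, and for $2\le t\le T$, $x^\pi_t:[0,U]_{\mathcal Q}^{t-1}\to\mathbb Q$ satisfies $x^\pi_{t}(\mathbf d)\ge x^\pi_{t-1}(\mathbf d_{[t-2]})-d_{t-1}$ for all $\mathbf d\in[0,U]_{\mathcal Q}^{t-1}$. $\Pi$ is the set of admissible policies with all values $x^\pi_t(\cdot)\in[0,U]$. The cost in period $t$ is $C^\pi_t=C(x^\pi_t(D_{[t-1]}),D_t)$, where $D=(D_1,\dots,D_T)$ is the demand vector. $\mathfrak M(\mu)$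 is the set of probability measures on $[0,U]_{\mathcal Q}$ with mean $\mu$. $\mathbf{IND}_T$ is the set of $T$-fold product measures with all marginals in $\mathfrak M(\mu)$. $\mathbf{MAR}_T$ is the set of probability measures on $[0,U]_{\mathcal Q}^T$ under which $(D_1,\dots,D_T)$ is a martingale with each marginal in $\mathfrak M(\mu)$. *)

(* Defs.v *)
From HB Require Import structures.
From mathcomp Require Export all_boot all_order all_algebra.
From mathcomp Require Export all_classical all_reals all_analysis.
Export Order.TTheory GRing.Theory Num.Theory.
Export numFieldNormedType.Exports.

Set Implicit Arguments.
Unset Strict Implicit.
Unset Printing Implicit Defensive.

Local Open Scope classical_set_scope.
Local Open Scope ring_scope.

(* The set of rationals of [0, U]. The proof of 0 < U is a parameter of the
   type because measurable types are required to be pointed. *)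
Definition demand (U : rat) (U0 : 0 < U) : Type := {d : rat | 0 <= d <= U}.

Section demand_instances.
Variables (U : rat) (U0 : 0 < U).

Let demand_point : demand U0 :=
  exist _ 0 (introT andP (conj (lexx 0) (ltW U0))).

Definition dval (d : demand U0) : rat := proj1_sig d.

HB.instance Definition _ := [isSub for dval].
HB.instance Definition _ := [Countable of demand U0 by <:].
HB.instance Definition _ := isPointed.Build (demand U0) demand_point.
HB.instance Definition _ := @isMeasurable.Build default_measure_display
  (demand U0) discrete_measurable discrete_measurable0
  discrete_measurableC discrete_measurableU.

End demand_instances.

Definition dvalR (R : realType) (U : rat) (U0 : 0 < U) (d : demand U0) : R :=
  ratr (dval d).

(* prefix_tuple H d = (d_1, ..., d_s) *)
Definition prefix_tuple (A : Type) (s t : nat) (H : (s <= t)%N)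
  (d : t.-tuple A) : s.-tuple A := [tuple tnth d (widen_ord H i) | i < s].

Definition cost (b x d : rat) : rat :=
  b * Num.max (d - x) 0 + Num.max (x - d) 0.

(* Periods are numbered from 0: for x : policy U0 T, the component x t, of
   arity t, is the order-up-to level of period t + 1. *)
Definition policy (U : rat) (U0 : 0 < U) (T : nat) : Type :=
  forall t : 'I_T, t.-tuple (demand U0) -> rat.

Definition admissible (U : rat) (U0 : 0 < U) (x0 : rat) (T : nat)
    (x : policy U0 T) : Prop :=
  (forall H : (0 < T)%N, x0 <= x (Ordinal H) [tuple]) /\
  (forall (t : nat) (H : (t.+1 < T)%N) (d : t.+1.-tuple (demand U0)),
     x (Ordinal (ltnW H)) (prefix_tuple (leqnSn t) d) - dval (tnth d ord_max)
       <= x (Ordinal H) d).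

Definition Pi_set (U : rat) (U0 : 0 < U) (x0 : rat) (T : nat) :
    set (policy U0 T) :=
  [set x | admissible x0 x /\
           forall (t : 'I_T) (d : t.-tuple (demand U0)), 0 <= x t d <= U].

Definition total_cost (R : realType) (U : rat) (U0 : 0 < U) (b : rat) (T : nat)
    (x : policy U0 T) (d : T.-tuple (demand U0)) : R :=
  \sum_(t < T)
    ratr (cost b (x t (prefix_tuple (ltnW (ltn_ord t)) d)) (dval (tnth d t))).

Definition mean_set (R : realType) (U : rat) (U0 : 0 < U) (mu : rat) :
    set (probability (demand U0) R) :=
  [set P | 'E_P[@dvalR R U U0] = (ratr mu)%:E]%E.

(* Rectangles generate the sigma-algebra of T.-tuple (demand U0), which
   contains every subset since demand U0 is countable and discrete. *)
Definition is_product_measure (R : realType) (U : rat) (U0 : 0 < U) (T : nat)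
    (P : 'I_T -> probability (demand U0) R)
    (Q : probability (T.-tuple (demand U0)) R) : Prop :=
  forall A : 'I_T -> set (demand U0), (forall i, measurable (A i)) ->
    (Q [set d | forall i, A i (tnth d i)] = \prod_(i < T) P i (A i))%E.

Definition IND (R : realType) (U : rat) (U0 : 0 < U) (mu : rat) (T : nat) :
    set (probability (T.-tuple (demand U0)) R) :=
  [set Q | exists P : 'I_T -> probability (demand U0) R,
     (forall i, mean_set mu (P i)) /\ is_product_measure P Q].

(* Y is a version of the conditional expectation of X given the
   sub-sigma-algebra G *)
Definition is_cond_expectation d (W : measurableType d) (R : realType)
    (P : probability W R) (G : set (set W)) (X Y : W -> R) : Prop :=
  [/\ (forall B : set R, measurable B -> G (Y @^-1` B)),
      P.-integrable setT (EFin \o Y) &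
      forall A, G A ->
        (\int[P]_(w in A) (Y w)%:E = \int[P]_(w in A) (X w)%:E)%E].

(* sigma(D_1, ..., D_s) *)
Definition sigma_prefix (U : rat) (U0 : 0 < U) (T s : nat) (H : (s <= T)%N) :
    set (set (T.-tuple (demand U0))) :=
  preimage_set_system setT (@prefix_tuple (demand U0) s T H) measurable.

Definition is_martingale (R : realType) (U : rat) (U0 : 0 < U) (T : nat)
    (Q : probability (T.-tuple (demand U0)) R) : Prop :=
  (forall t : 'I_T,
     Q.-integrable setT (fun d => (@dvalR R U U0 (tnth d t))%:E)) /\
  (forall (t : nat) (H : (t.+1 < T)%N),
     is_cond_expectation Q (@sigma_prefix U U0 T _ (ltnW H))
       (fun d => dvalR R (tnth d (Ordinal H)))
       (fun d => dvalR R (tnth d (Ordinal (ltnW H))))).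

Definition coordinate (U : rat) (U0 : 0 < U) (T : nat) (t : 'I_T)
  (d : T.-tuple (demand U0)) : demand U0 := tnth d t.

HB.instance Definition _ (U : rat) (U0 : 0 < U) (T : nat) (t : 'I_T) :=
  isMeasurableFun.Build _ _ _ _ (@coordinate U U0 T t) (measurable_tnth t).

Definition MAR (R : realType) (U : rat) (U0 : 0 < U) (mu : rat) (T : nat) :
    set (probability (T.-tuple (demand U0)) R) :=
  [set Q | is_martingale Q /\
           forall t : 'I_T, mean_set mu (distribution Q (@coordinate U U0 T t))].

Definition minimax_value (R : realType) (U : rat) (U0 : 0 < U) (b x0 : rat)
    (T : nat) (M : set (probability (T.-tuple (demand U0)) R)) : \bar R :=
  ereal_inf [set ereal_sup [set 'E_Q[total_cost R b x] | Q in M]%E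
            | x in @Pi_set U U0 x0 T].

(* Main.v *)
From HB Require Import structures.
Require Import Defs.
From mathcomp Require Import measurable_realfun ring.

(** Starting from a full stock [U], the two worst cases have different growth
rates in [T], and only these rates matter for the ratio.

Martingale demand. The policy that always orders up to [U] pays [U - D_t] in
period [t], so [T * (U - mu)] suffices ([MAR_upper]). No policy does better:
let the demand be constant over time, equal to [U] with probability [mu / U]
and to [0] otherwise. This is a martingale, and in the second case the stock
can never leave the level [U], which costs [U] in each period
([policy_at_zero_demand], [MAR_lower]). Hence the value is exactly
[T * (U - mu)].

Independent demand. When every marginal is the two-point law on [{0, U}] with
mean [mu], the expected cost of a period is affine in the stock level, with
nonnegative slope because [(b + 1) * mu < U]; so every period costs at least
its value [b * mu] at stock level [0] ([IND_lower]). Conversely a policy can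
run the stock down: the levels [x_t = U * prod_(i < t) (1 - d_i / U)] are
admissible, because lowering a stock [x <= U] by the fraction [d / U] removes
at most [d]. By independence [E x_t = U * (1 - mu / U) ^ t], whose sum over
[t] is at most [U ^ 2 / mu], and the cost of a period is at most
[b * d_t + x_t] ([IND_upper]). Hence the value lies between [T * b * mu] and
[T * b * mu + U ^ 2 / mu], and the ratio tends to [(U - mu) / (b * mu)].

The multiplicativity of expectations is [integral_product_measure]. *)

Set Implicit Arguments.
Unset Strict Implicit.
Unset Printing Implicit Defensive.

Local Open Scope classical_set_scope.
Local Open Scope ring_scope.

(** * Measures on countable spaces and finite mixtures *)

(** The space of tuples is countable and its singletons are rectangles; so
every function on it is measurable. *)
Lemma measurable_demand_tuple (U : rat) (U0 : 0 < U) (T : nat)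
  (A : set (T.-tuple (demand U0))) : measurable A.
Proof.
apply: countable_measurable => [d|]; last exact: countableP.
have -> : [set d] = \bigcap_(i in [set: 'I_T])
    (fun e : T.-tuple (demand U0) => tnth e i) @^-1` [set tnth d i].
  apply/seteqP; split=> [e -> //|e de]; apply: eq_from_tnth => i.
  exact: de.
rewrite bigcap_fset_set//; last exact: finite_finset.
apply: bigsetI_measurable => i _.
by rewrite -[X in measurable X]setTI; exact: measurable_tnth.
Qed.

Lemma measurable_fun_discrete d d' (X : measurableType d)
    (Y : measurableType d') (D : set X) (f : X -> Y) :
  (forall A : set X, measurable A) -> measurable_fun D f.
Proof. by move=> mX mD B mB; exact: mX. Qed.

Section mixture.
Context d (X : measurableType d) (R : realType) (I : finType).
Variables (w : I -> R) (x : I -> X).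
Hypothesis w0 : forall i, 0 <= w i.

Lemma exists_mixture_measure (s : seq I) :
  exists m : {measure set X -> \bar R}, forall f : X -> R,
    measurable_fun setT f -> (forall y, 0 <= f y) ->
    (\int[m]_y (f y)%:E = (\sum_(i <- s) w i * f (x i))%:E)%E.
Proof.
elim: s => [|i s [m hm]].
  by exists mzero => f mf f0; rewrite integral_measure_zero big_nil.
exists (measure_add (mscale (NngNum (w0 i)) \d_(x i)) m) => f mf f0.
have mEf : measurable_fun setT (fun y => (f y)%:E) by exact/measurable_EFinP.
rewrite ge0_integral_measure_add//; last by move=> y _; rewrite lee_fin.
rewrite ge0_integral_mscale//; last by move=> y _; rewrite lee_fin.
by rewrite integral_dirac// diracT mul1e hm// big_cons EFinD EFinM.
Qed.

(** The measure is [\sum_i w i * dirac (x i)], described through its integrals.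
Both worst-case demand laws are of this form. *)
Lemma exists_mixture : \sum_i w i = 1 ->
  exists P : probability X R, forall f : X -> R,
    measurable_fun setT f -> (forall y, 0 <= f y) ->
    (\int[P]_y (f y)%:E = (\sum_i w i * f (x i))%:E)%E.
Proof.
move=> w1; have [m hm] := exists_mixture_measure (index_enum I).
have m1 : m setT = 1%E.
  rewrite -[LHS]mul1e -(integral_cst m measurableT).
  rewrite (hm (fun=> 1))//.
  by under eq_bigr do rewrite mulr1; rewrite w1.
(* m already has total mass 1: normalizing only packages it as a probability *)
have mE (A : set X) : mnormalize m \d_point A = m A.
  rewrite /mnormalize m1 onee_eq0 orFb (_ : (1 == +oo)%E = false)//.
  by rewrite invr1 mule1.
exists (mnormalize m \d_point) => f mf f0; rewrite -hm//.
by apply: eq_measure_integral => A mA _; exact: mE.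
Qed.

End mixture.

Lemma probability_integral_indic d (X : measurableType d) (R : realType)
  (P : probability X R) (A : set X) : measurable A ->
  P A = (\int[P]_y (\1_A y)%:E)%E.
Proof. by move=> mA; rewrite integral_indic// setIT. Qed.

(** The space is cut into the fibers of [h] over the points of [Y], listed by
[pickle]; indices that code no point give empty pieces. *)
Lemma integral_countable_partition d (X : measurableType d) (R : realType)
    (m : {measure set X -> \bar R}) (Y : countType) (h : X -> Y)
    (F : X -> \bar R) :
  (forall A : set X, measurable A) -> (forall x, 0 <= F x)%E ->
  (\int[m]_x F x
   = \sum_(0 <= n <oo) \int[m]_x (F x * (\1_[set y | pickle y = n] (h x))%:E))%E.
Proof.
move=> mX F0; pose A n := [set x | pickle (h x) = n].
have UA : [set: X] = \bigcup_n A n.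
  by apply/seteqP; split=> x // _; exists (pickle (h x)).
rewrite [in LHS]UA ge0_integral_bigcup//; last first.
  by move=> i j _ _ [x [<- <-]].
apply: eq_eseriesr => n _; rewrite integral_mkcond.
apply: eq_integral => x _; rewrite /patch indicE.
have -> : (x \in A n) = (h x \in [set y | pickle y = n]) by [].
by case: ifP; rewrite ?mule1 ?mule0.
Qed.

(** Fubini for a measure known only through its values on rectangles. For
indicator functions the claim is the definition of a product measure. The
induction turns the indicators into arbitrary functions one coordinate at a
time: on the fiber of the coordinate [j] over its [n]-th possible value, [f j]
is a constant [c n], so the integral is a series of integrals with an
indicator in place of [f j]. *)
Lemma integral_product_measure (R : realType) (U : rat) (U0 : 0 < U) (T : nat)
    (P : 'I_T -> probability (demand U0) R)
    (Q : probability (T.-tuple (demand U0)) R)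
    (f : 'I_T -> demand U0 -> R) (a : 'I_T -> R) :
  is_product_measure P Q -> (forall i x, 0 <= f i x) ->
  (forall i, (\int[P i]_x (f i x)%:E = (a i)%:E)%E) ->
  (\int[Q]_d (\prod_i f i (tnth d i))%:E = (\prod_i a i)%:E)%E.
Proof.
move=> PQ.
have allT (A : set (T.-tuple (demand U0))) : measurable A.
  exact: measurable_demand_tuple.
suff: forall k (f : 'I_T -> demand U0 -> R) (a : 'I_T -> R),
    (forall i : 'I_T, (k <= i)%N -> exists A, f i = \1_A) ->
    (forall i x, 0 <= f i x) ->
    (forall i, (\int[P i]_x (f i x)%:E = (a i)%:E)%E) ->
    (\int[Q]_d (\prod_i f i (tnth d i))%:E = (\prod_i a i)%:E)%E.
  move=> /(_ T f a) H f0 fa; apply: H => // i.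
  by rewrite leqNgt ltn_ord.
elim=> [|k IH] {}f {}a fA f0 fa.
  have /choice[A fE] : forall i, exists A, f i = \1_A by move=> i; exact: fA.
  rewrite -prodEFin.
  transitivity (Q [set d | forall i, A i (tnth d i)]).
    rewrite probability_integral_indic//; apply: eq_integral => d _.
    congr EFin; rewrite indicE; under eq_bigr do rewrite fE indicE.
    have [dA|/existsNP[i dA]] := pselect (forall i, A i (tnth d i)).
      by rewrite mem_set// big1// => i _; rewrite mem_set.
    rewrite memNset; last by move=> /(_ i).
    by rewrite (bigD1 i)//= memNset// mul0r.
  rewrite PQ//; apply: eq_bigr => i _; rewrite -fa fE.
  exact: probability_integral_indic.
have [Tk|kT] := leqP T k.
  by apply: IH => // i /(leq_trans Tk); rewrite leqNgt ltn_ord.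
pose j := Ordinal kT.
(* an index n that codes no point gets the value 0; there g n vanishes anyway *)
pose g n : demand U0 -> R := \1_[set y | pickle y = n].
pose c n := if unpickle n is Some y then f j y else 0.
have c0 n : 0 <= c n by rewrite /c; case: unpickle.
have fg n x : f j x * g n x = c n * g n x.
  rewrite /g indicE; have [<-|nx] := eqVneq (pickle x) n.
    by rewrite /c pickleK.
  by rewrite memNset ?mulr0// => /eqP; rewrite (negbTE nx).
pose p n := fine (P j [set y | pickle y = n]).
have gp n : (\int[P j]_x (g n x)%:E = (p n)%:E)%E.
  by rewrite /p fineK ?fin_num_measure// probability_integral_indic.
have ajE : ((a j)%:E = \sum_(0 <= n <oo) (c n * p n)%:E)%E.
  rewrite -fa.
  rewrite (integral_countable_partition _ (fun y : demand U0 => y))//.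
    apply: eq_eseriesr => n _; rewrite EFinM -gp -ge0_integralZl//.
    - by apply: eq_integral => x _; rewrite -!EFinM fg.
    - by move=> x _; rewrite lee_fin /g indicE.
    - by rewrite lee_fin.
  by move=> x; rewrite lee_fin.
rewrite (integral_countable_partition _ (fun d => tnth d j : demand U0))//.
  2: by move=> d; rewrite lee_fin prodr_ge0.
rewrite (bigD1 j)//= EFinM ajE muleC -nneseriesZl; last first.
  by move=> n _; rewrite lee_fin mulr_ge0// fine_ge0.
apply: eq_eseriesr => n _; rewrite -EFinM.
pose f' i := if i == j then g n else f i.
pose a' i := if i == j then p n else a i.
have f'j i : i != j -> f' i = f i by rewrite /f' => /negbTE ->.
have a'j i : i != j -> a' i = a i by rewrite /a' => /negbTE ->.
have f'jj : f' j = g n by rewrite /f' eqxx.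
have a'jj : a' j = p n by rewrite /a' eqxx.
have IHn : (\int[Q]_d (\prod_i f' i (tnth d i))%:E = (\prod_i a' i)%:E)%E.
  apply: IH => [i ki|i x|i]; rewrite /f' /a';
    have [E|ij] := eqVneq i j; rewrite ?E//.
  - by exists [set y | pickle y = n].
  - apply: fA; rewrite ltn_neqAle ki andbT.
    by apply: contra ij => /eqP ?; apply/eqP/val_inj.
transitivity ((c n)%:E * \int[Q]_d (\prod_i f' i (tnth d i))%:E)%E.
  rewrite -ge0_integralZl//; last 2 first.
  - by move=> d _; rewrite lee_fin prodr_ge0// => i _; rewrite /f'; case: ifP.
  - by rewrite lee_fin.
  apply: eq_integral => d _; rewrite -!EFinM; congr EFin.
  rewrite (bigD1 j)//= [in RHS](bigD1 j)//= f'jj mulrAC fg -mulrA.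
  by under [in RHS]eq_bigr => i ij do rewrite f'j//.
rewrite IHn (bigD1 j)//= a'jj -EFinM; congr EFin.
under eq_bigr => i ij do rewrite a'j//.
ring.
Qed.

(** The bound [k * f <= c] keeps the integrand nonnegative, so that
additivity of nonnegative integrals applies. *)
Lemma integral_affine d (X : measurableType d) (R : realType)
    (P : probability X R) (f : X -> R) (m c k : R) :
  measurable_fun setT f -> (forall x, 0 <= f x) ->
  (\int[P]_x (f x)%:E = m%:E)%E -> 0 <= k -> (forall x, k * f x <= c) ->
  (\int[P]_x (c - k * f x)%:E = (c - k * m)%:E)%E.
Proof.
move=> mf f0 fm k0 kfc.
have kf0 x : 0 <= k * f x by rewrite mulr_ge0.
have mkf : measurable_fun setT (fun x => k * f x) by exact: measurable_funM.
have ikf : (\int[P]_x (k * f x)%:E = (k * m)%:E)%E.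
  under eq_integral do rewrite EFinM.
  rewrite ge0_integralZl ?fm//; first exact/measurable_EFinP.
  by move=> x _; rewrite lee_fin.
have : (\int[P]_x (c - k * f x)%:E + (k * m)%:E = c%:E)%E.
  rewrite -ikf -ge0_integralD//.
  - under eq_integral do rewrite -EFinD subrK.
    by rewrite integral_cst//= probability_setT mule1.
  - by move=> x _; rewrite lee_fin subr_ge0.
  - by apply/measurable_EFinP/measurable_funB.
  - by move=> x _; rewrite lee_fin.
  - exact/measurable_EFinP.
case: (\int[P]_x _)%E => [r||] //= [<-]; congr EFin; ring.
Qed.

(** * Demands, costs and minimax values *)

Section minimax.
Variables (R : realType) (U : rat) (U0 : 0 < U).
Implicit Types (b : rat) (T : nat).

Lemma dval_ge0 (d : demand U0) : 0 <= dval d. Proof. by case: d => /= r /andP[]. Qed.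

Lemma dval_le (d : demand U0) : dval d <= U. Proof. by case: d => /= r /andP[]. Qed.

Lemma dvalR_ge0 (d : demand U0) : 0 <= dvalR R d.
Proof. by rewrite ler0q dval_ge0. Qed.

Lemma dvalR_le (d : demand U0) : dvalR R d <= ratr U.
Proof. by rewrite ler_rat dval_le. Qed.

Lemma measurable_fun_demand d' (Y : measurableType d') (f : demand U0 -> Y) :
  measurable_fun setT f.
Proof. exact: measurable_fun_discrete. Qed.

Lemma measurable_fun_demand_tuple d' (Y : measurableType d') T
  (f : T.-tuple (demand U0) -> Y) : measurable_fun setT f.
Proof.
by apply: measurable_fun_discrete => A; exact: measurable_demand_tuple.
Qed.

Lemma cost_ge0 b (x y : rat) : 0 <= b -> 0 <= cost b x y.
Proof.
by move=> b0; rewrite addr_ge0 ?mulr_ge0// le_max lexx orbT.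
Qed.

Lemma minimax_value_le b (x0 : rat) T
    (M : set (probability (T.-tuple (demand U0)) R))
    (x : policy U0 T) (c : \bar R) :
  Pi_set x0 x ->
  (forall Q, M Q -> (\int[Q]_d (total_cost R b x d)%:E <= c)%E) ->
  (minimax_value b x0 M <= c)%E.
Proof.
move=> xPi H; apply: (@le_trans _ _
    (ereal_sup [set 'E_Q[total_cost R b x] | Q in M]%E)).
  by apply: ereal_inf_lbound; exists x.
by apply: ge_ereal_sup => _ [Q MQ <-]; rewrite unlock; exact: H.
Qed.

Lemma minimax_value_ge b (x0 : rat) T
    (M : set (probability (T.-tuple (demand U0)) R))
    (Q : probability (T.-tuple (demand U0)) R) (c : \bar R) :
  M Q ->
  (forall x : policy U0 T, Pi_set x0 x ->
    (c <= \int[Q]_d (total_cost R b x d)%:E)%E) ->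
  (c <= minimax_value b x0 M)%E.
Proof.
move=> MQ H; apply: le_ereal_inf_tmp => _ [x xPi <-].
apply: (le_trans (H x xPi)).
by apply: ereal_sup_ubound; exists Q => //; rewrite unlock.
Qed.

Lemma integral_total_cost b T (x : policy U0 T)
    (Q : probability (T.-tuple (demand U0)) R) : 0 <= b ->
  (\int[Q]_d (total_cost R b x d)%:E =
   \sum_(t < T) \int[Q]_d
     (ratr (cost b (x t (prefix_tuple (ltnW (ltn_ord t)) d))
       (dval (tnth d t))))%:E)%E.
Proof.
move=> b0; rewrite -ge0_integral_sum//.
- by apply: eq_integral => d _; rewrite sumEFin.
- by move=> t; exact: measurable_fun_demand_tuple.
- by move=> t d _; rewrite lee_fin ler0q cost_ge0.
Qed.

(** * Martingale demand *)

Lemma MAR_upper b (mu : rat) T : 0 <= b ->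
  (minimax_value b U (@MAR R U U0 mu T) <= (T%:R * ratr (U - mu) : R)%:E)%E.
Proof.
move=> b0; apply: (@minimax_value_le _ _ _ _ (fun _ _ => U)).
  split; first split=> // t H d.
    by rewrite lerBlDr lerDl dval_ge0.
  by move=> t d; rewrite lexx ltW.
move=> Q [_ Qmu]; rewrite integral_total_cost//.
have costE (d : demand U0) : ratr (cost b U (dval d)) = ratr U - 1 * dvalR R d.
  rewrite /cost max_r ?subr_le0 ?dval_le// mulr0 add0r max_l.
    by rewrite rmorphB mul1r.
  by rewrite subr_ge0 dval_le.
rewrite (eq_bigr (fun=> (ratr (U - mu))%:E)) => [|t _].
  by rewrite sumEFin sumr_const card_ord mulr_natl.
under eq_integral do rewrite costE.
rewrite (@integral_affine _ _ _ _ _ (ratr mu)).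
- by rewrite rmorphB mul1r.
- exact: measurable_fun_demand_tuple.
- by move=> d; exact: dvalR_ge0.
- have := Qmu t; rewrite /mean_set/= unlock => <-.
  rewrite ge0_integral_distribution//.
  by move=> d; rewrite lee_fin dvalR_ge0.
- by [].
- by move=> d; rewrite mul1r dvalR_le.
Qed.


(** The end points of the demand interval; [extreme_weight mu] is the law with
mean [mu] that they carry. *)
Definition extreme (s : bool) : demand U0 :=
  if s then exist _ U (introT andP (conj (ltW U0) (lexx U)))
  else exist _ 0 (introT andP (conj (lexx 0) (ltW U0))).

Definition extreme_weight (mu : rat) (s : bool) : rat :=
  if s then mu / U else 1 - mu / U.

Lemma extreme_weight_ge0 mu s : 0 <= mu -> mu <= U -> 0 <= extreme_weight mu s.
Proof.
move=> mu0 muU; case: s => /=; first by rewrite divr_ge0// ltW.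
by rewrite subr_ge0 ler_pdivrMr// mul1r.
Qed.

Lemma sum_extreme_weight mu : \sum_s (ratr (extreme_weight mu s) : R) = 1.
Proof. by rewrite big_bool/= -rmorphD subrKC rmorph1. Qed.

Lemma extreme_mean mu :
  \sum_s ratr (extreme_weight mu s) * dvalR R (extreme s) = ratr mu.
Proof.
by rewrite big_bool/= /dvalR/= rmorph0 mulr0 addr0 -rmorphM divfK ?gt_eqF.
Qed.

(** All coordinates coincide on the support of [Q], so the last observed
demand is its own conditional expectation. *)
Lemma constant_demand_in_MAR (mu : rat) T
    (Q : probability (T.-tuple (demand U0)) R) :
  (forall f : T.-tuple (demand U0) -> R, (forall y, 0 <= f y) ->
    (\int[Q]_y (f y)%:E = (\sum_s ratr (extreme_weight mu s)
                                * f [tuple extreme s | _ < T])%:E)%E) ->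
  MAR mu Q.
Proof.
move=> QE; split; last first.
  move=> t; rewrite /mean_set/= unlock ge0_integral_distribution//; last first.
    by move=> y; rewrite lee_fin dvalR_ge0.
  rewrite /comp QE => [|y]; last exact: dvalR_ge0.
  rewrite -extreme_mean; congr EFin; apply: eq_bigr => s _.
  by congr (_ * dvalR R _); rewrite [LHS]tnth_mktuple.
have iD (t : 'I_T) : Q.-integrable setT (fun d => (dvalR R (tnth d t))%:E).
  apply/integrableP; split; first exact: measurable_fun_demand_tuple.
  under eq_integral do rewrite gee0_abs ?lee_fin ?dvalR_ge0//.
  by rewrite QE ?ltry// => y; exact: dvalR_ge0.
split=> // t H; split.
- move=> B mB.
  exists [set e : (t.+1).-tuple (demand U0) | B (dvalR R (tnth e ord_max))].
    exact: measurable_demand_tuple.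
  rewrite setTI; apply/seteqP; split=> d /=; rewrite tnth_mktuple;
    by congr (B (dvalR R (tnth d _))); exact: val_inj.
- exact: iD.
- move=> A _.
  have int (s : 'I_T) : (\int[Q]_(w in A) (dvalR R (tnth w s))%:E =
     (\sum_s ratr (extreme_weight mu s)
        * (dvalR R (extreme s) * \1_A [tuple extreme s | _ < T]))%:E)%E.
    rewrite integral_mkcond; transitivity
      (\int[Q]_w (dvalR R (tnth w s) * \1_A w)%:E)%E.
      apply: eq_integral => w _; rewrite /patch indicE.
      by case: ifP; rewrite ?mulr1 ?mulr0.
    rewrite QE => [|w]; last by rewrite mulr_ge0 ?dvalR_ge0// indicE.
    by under eq_bigr do rewrite tnth_mktuple.
  by rewrite !int.
Qed.

(** Nothing is ever sold, and the stock starts at its upper bound [U]. *)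
Lemma policy_at_zero_demand T (x : policy U0 T) (t : 'I_T) : Pi_set U x ->
  x t [tuple extreme false | _ < t] = U.
Proof.
move=> [[x0 xS] xU]; apply/eqP; rewrite eq_le; apply/andP; split.
  by have /andP[] := xU t [tuple extreme false | _ < t].
case: t => t; elim: t => [|t IH] tT.
  have -> : [tuple extreme false | _ < Ordinal tT] = [tuple] by exact: tuple0.
  exact: x0.
apply: le_trans (xS t tT [tuple extreme false | _ < t.+1]).
rewrite tnth_mktuple subr0 (_ : prefix_tuple _ _ = [tuple extreme false | _ < t]).
  exact: IH.
by apply: eq_from_tnth => i; rewrite !tnth_mktuple.
Qed.

Lemma MAR_lower b (mu : rat) T : 0 <= b -> 0 <= mu -> mu <= U ->
  ((T%:R * ratr (U - mu) : R)%:E <= minimax_value b U (@MAR R U U0 mu T))%E.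
Proof.
move=> b0 mu0 muU.
have w0 s : 0 <= ratr (extreme_weight mu s) :> R.
  by rewrite ler0q extreme_weight_ge0.
have [Q QE] := exists_mixture (fun s => [tuple extreme s | _ < T]) w0
  (sum_extreme_weight mu).
have {}QE f := QE f (measurable_fun_demand_tuple f).
apply: (minimax_value_ge (constant_demand_in_MAR QE)) => x xPi.
have total0 y : 0 <= total_cost R b x y.
  by apply: sumr_ge0 => t _; rewrite ler0q cost_ge0.
(* only the scenario with zero demand is kept *)
rewrite QE// lee_fin big_bool/= -[leLHS]add0r lerD//.
  by rewrite mulr_ge0// ler0q (@extreme_weight_ge0 mu true).
rewrite /total_cost (eq_bigr (fun=> ratr U)) => [|t _]; last first.
  congr ratr; rewrite (_ : prefix_tuple _ _ = [tuple extreme false | _ < t]).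
    rewrite policy_at_zero_demand// tnth_mktuple /cost/= max_r ?subr0.
      by rewrite mulr0 add0r max_l// ltW.
    by rewrite sub0r oppr_le0 ltW.
  by apply: eq_from_tnth => i; rewrite !tnth_mktuple.
rewrite sumr_const card_ord -[X in _ <= _ * X]mulr_natl [leRHS]mulrCA -rmorphM.
by rewrite mulrBl mul1r divfK ?gt_eqF.
Qed.

End minimax.

(** * Independent demand: running the stock down *)

Section independent.
Variables (R : realType) (U : rat) (U0 : 0 < U).
Implicit Types (b mu : rat) (T : nat).

(** Each period sells the fraction [d / U] of the stock. The base-stock level
[max (U - \sum_i d_i) 0] would be lower, but a product of functions of the
single demands has an explicit mean under independence. *)
Definition unsold_policy T : policy U0 T :=
  fun t d => U * \prod_i (1 - dval (tnth d i) / U).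

Lemma unsold_fraction (d : demand U0) : 0 <= 1 - dval d / U <= 1.
Proof.
rewrite subr_ge0 ler_pdivrMr// mul1r dval_le/= lerBlDr lerDl.
by rewrite divr_ge0 ?dval_ge0// ltW.
Qed.

Lemma unsold_policy_Pi T : Pi_set U (unsold_policy (T := T)).
Proof.
have bound (t : 'I_T) (d : t.-tuple (demand U0)) : 0 <= unsold_policy d <= U.
  have frac i : 0 <= 1 - dval (tnth d i) / U <= 1 by exact: unsold_fraction.
  rewrite mulr_ge0 ?(ltW U0)//=; last first.
    by apply: prodr_ge0 => i _; case/andP: (frac i).
  by rewrite ler_piMr ?(ltW U0)// prodr_ile1.
split=> //; split=> [H|t H d]; first by rewrite /unsold_policy big_ord0 mulr1.
have /andP[] := bound (Ordinal (ltnW H)) (prefix_tuple (leqnSn t) d).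
rewrite /unsold_policy big_ord_recr/= mulrA.
under eq_bigr do rewrite tnth_mktuple.
set y := U * _ => y0 yU.
(* y * (d / U) <= d because y <= U *)
rewrite mulrBr mulr1 lerB// mulrCA ler_piMr ?dval_ge0//.
by rewrite ler_pdivrMr// mul1r.
Qed.

Lemma cost_le b (x y : rat) : 0 <= b -> 0 <= x -> 0 <= y ->
  cost b x y <= b * y + x.
Proof.
move=> b0 x0 y0; apply: lerD; last by rewrite ge_max x0 andbT gerBl.
by rewrite ler_wpM2l// ge_max y0 andbT gerBl.
Qed.

Lemma IND_integral_demand mu T (Q : probability (T.-tuple (demand U0)) R)
    (t : 'I_T) :
  IND mu Q -> (\int[Q]_d (dvalR R (tnth d t))%:E = (ratr mu)%:E)%E.
Proof.
move=> [P [Pmu PQ]].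
pose f (i : 'I_T) : demand U0 -> R := if i == t then @dvalR R U U0 else cst 1.
pose a (i : 'I_T) : R := if i == t then ratr mu else 1.
have ft : f t = @dvalR R U U0 by rewrite /f eqxx.
have fN i : i != t -> f i = cst 1 by rewrite /f => /negbTE ->.
have aN i : i != t -> a i = 1 by rewrite /a => /negbTE ->.
transitivity (\int[Q]_d (\prod_i f i (tnth d i))%:E)%E.
  apply: eq_integral => d _; rewrite (bigD1 t)//= ft big1 ?mulr1// => i it.
  by rewrite fN.
rewrite (integral_product_measure (a := a) PQ).
- by rewrite (bigD1 t)//= big1 ?mulr1 /a ?eqxx// => i /negbTE ->.
- by move=> i x; rewrite /f; case: ifP => _; rewrite ?dvalR_ge0.
- move=> i; rewrite /f /a; case: ifP => _.
    by have := Pmu i; rewrite /mean_set/= unlock.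
  by have := expectation_cst (P i) 1; rewrite unlock.
Qed.

Lemma IND_integral_unsold mu T (Q : probability (T.-tuple (demand U0)) R)
    (t : 'I_T) :
  IND mu Q ->
  (\int[Q]_d (ratr (unsold_policy (prefix_tuple (ltnW (ltn_ord t)) d)))%:E
   = (ratr (U * (1 - mu / U) ^+ t))%:E)%E.
Proof.
move=> [P [Pmu PQ]].
(* the coordinates from t on are given the constant factor 1 *)
pose f (i : 'I_T) (x : demand U0) : R :=
  if (i < t)%N then 1 - (ratr U)^-1 * dvalR R x else 1.
pose a (i : 'I_T) : R := if (i < t)%N then 1 - (ratr U)^-1 * ratr mu else 1.
have u0 : 0 < ratr U :> R by rewrite ltr0q.
have frac (x : demand U0) : (ratr U)^-1 * dvalR R x <= 1.
  rewrite mulrC ler_pdivrMr// mul1r; exact: dvalR_le.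
have f0 i x : 0 <= f i x by rewrite /f; case: ifP; rewrite ?subr_ge0.
have fa i : (\int[P i]_x (f i x)%:E = (a i)%:E)%E.
  rewrite /f /a; case: ifP => _; last first.
    by have := expectation_cst (P i) 1; rewrite unlock.
  apply: integral_affine => //.
  - by move=> x; exact: dvalR_ge0.
  - by have := Pmu i; rewrite /mean_set/= unlock.
  - by rewrite invr_ge0 ltW.
transitivity (\int[Q]_d ((ratr U)%:E * (\prod_i f i (tnth d i))%:E))%E.
  apply: eq_integral => d _; rewrite -EFinM rmorphM rmorph_prod/=; congr (_ * _)%:E.
  rewrite /f -big_mkcond (big_ord_narrow (ltnW (ltn_ord t))).
  apply: eq_bigr => i _; rewrite tnth_mktuple rmorphB rmorph1 fmorph_div/= mulrC.
  by rewrite mulrC.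
rewrite ge0_integralZl//.
- rewrite (integral_product_measure PQ f0 fa) -EFinM rmorphM rmorphXn.
  congr (_ * _)%:E.
  rewrite /a -big_mkcond (big_ord_narrow (ltnW (ltn_ord t))).
  by rewrite prodr_const card_ord rmorphB rmorph1 fmorph_div/= mulrC.
- exact: measurable_fun_demand_tuple.
- by move=> d _; rewrite lee_fin prodr_ge0.
- by rewrite lee_fin ltW.
Qed.

Lemma geometric_sum_le (r : rat) n : 0 <= r < 1 ->
  \sum_(t < n) r ^+ t <= (1 - r)^-1.
Proof.
move=> /andP[r0 r1]; rewrite -[leRHS]mul1r ler_pdivlMr ?subr_gt0//.
rewrite mulrC -opprB mulNr -subrX1 opprB lerBlDr lerDl.
by rewrite exprn_ge0.
Qed.

Lemma IND_upper b mu T : 0 <= b -> 0 < mu -> mu <= U ->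
  (minimax_value b U (@IND R U U0 mu T)
   <= (T%:R * ratr (b * mu) + ratr (U ^+ 2 / mu) : R)%:E)%E.
Proof.
move=> b0 mu0 muU; apply: (minimax_value_le (unsold_policy_Pi T)).
move=> Q QIND; rewrite integral_total_cost//.
apply: (@le_trans _ _ (\sum_(t < T)
    (ratr (b * mu + U * (1 - mu / U) ^+ t) : R)%:E)%E).
  apply: lee_sum => t _.
  pose X (d : T.-tuple (demand U0)) :=
    unsold_policy (prefix_tuple (ltnW (ltn_ord t)) d).
  have X0 d : 0 <= X d.
    have [_ bound] := unsold_policy_Pi T.
    by have /andP[] := bound t (prefix_tuple (ltnW (ltn_ord t)) d).
  apply: (@le_trans _ _
      (\int[Q]_d ((ratr b)%:E * (dvalR R (tnth d t))%:E + (ratr (X d))%:E)))%E.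
    apply: ge0_le_integral => //.
    - by move=> d _; rewrite lee_fin ler0q cost_ge0.
    - exact: measurable_fun_demand_tuple.
    - exact: measurable_fun_demand_tuple.
    - move=> d _; rewrite -EFinM -EFinD lee_fin -rmorphM -rmorphD ler_rat.
      exact: (cost_le b0 (X0 d) (dval_ge0 _)).
  rewrite ge0_integralD//.
  - rewrite (IND_integral_unsold t QIND) ge0_integralZl//.
    + by rewrite (IND_integral_demand t QIND) rmorphD rmorphM.
    + exact: measurable_fun_demand_tuple.
    + by move=> d _; rewrite lee_fin dvalR_ge0.
    + by rewrite lee_fin ler0q.
  - by move=> d _; rewrite mule_ge0// lee_fin ?dvalR_ge0 ?ler0q.
  - exact: measurable_fun_demand_tuple.
  - by move=> d _; rewrite lee_fin ler0q.
  - exact: measurable_fun_demand_tuple.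
rewrite sumEFin lee_fin -rmorph_sum big_split sumr_const card_ord rmorphD/=.
rewrite -[_ *+ T]mulr_natl rmorphM rmorph_nat lerD2l ler_rat -mulr_sumr.
rewrite expr2 -mulrA ler_wpM2l ?(ltW U0)//.
apply: le_trans (@geometric_sum_le _ _ _) _.
  by rewrite subr_ge0 ler_pdivrMr// mul1r muU gtrBl divr_gt0.
by rewrite subKr invf_div.
Qed.

End independent.

(** * Independent demand: two-point marginals *)

Definition flip (T : nat) (t : 'I_T) (s : {ffun 'I_T -> bool}) :
    {ffun 'I_T -> bool} :=
  [ffun i => if i == t then ~~ s i else s i].

Lemma flipK T (t : 'I_T) : involutive (flip t).
Proof.
by move=> s; apply/ffunP => i; rewrite !ffunE; case: eqP; rewrite ?negbK.
Qed.

(** Fixing the bits other than [t] and averaging over the bit [t] is done by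
pairing each [s] with [flip t s]; the sum is thereby counted twice. *)
Lemma sum_flip_ge0 (R : realFieldType) (T : nat) (t : 'I_T) (p : bool -> R)
    (g : {ffun 'I_T -> bool} -> R) :
  (forall s, 0 <= p s) ->
  (forall s : {ffun _}, 0 <= p (s t) * g s + p (~~ s t) * g (flip t s)) ->
  0 <= \sum_(s : {ffun _}) (\prod_i p (s i)) * g s.
Proof.
move=> p0 pg; pose w (s : {ffun 'I_T -> bool}) := \prod_(i | i != t) p (s i).
have wE (s : {ffun _}) : \prod_i p (s i) = p (s t) * w s by rewrite (bigD1 t).
have wflip s : w (flip t s) = w s.
  by apply: eq_bigr => i /negbTE it; rewrite ffunE it.
have flipt s : flip t s t = ~~ s t by rewrite ffunE eqxx.
set S := \sum_s _.
have SE : S = \sum_(s : {ffun _}) p (~~ s t) * w s * g (flip t s).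
  rewrite /S (reindex_inj (inv_inj (flipK t)))/=.
  by apply: eq_bigr => s _; rewrite wE flipt wflip.
rewrite -(pmulrn_lge0 _ (ltn0Sn 1)) mulr2n {2}SE -big_split/=.
apply: sumr_ge0 => s _; rewrite wE.
rewrite (_ : _ + _ = w s * (p (s t) * g s + p (~~ s t) * g (flip t s))).
  by rewrite mulr_ge0// prodr_ge0.
ring.
Qed.

Section independent_lower.
Variables (R : realType) (U : rat) (U0 : 0 < U).
Implicit Types (b mu : rat) (T : nat).

Definition extreme_path T (s : {ffun 'I_T -> bool}) : T.-tuple (demand U0) :=
  [tuple extreme U0 (s i) | i < T].

(** The probability of [extreme_path s] when the demands are independent. *)
Definition path_weight mu T (s : {ffun 'I_T -> bool}) : R :=
  \prod_i ratr (extreme_weight U mu (s i)).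

Lemma extreme_paths_in_IND mu T (Q : probability (T.-tuple (demand U0)) R) :
  0 <= mu -> mu <= U ->
  (forall f : T.-tuple (demand U0) -> R, (forall y, 0 <= f y) ->
    (\int[Q]_y (f y)%:E = (\sum_s path_weight mu s * f (extreme_path s))%:E)%E) ->
  IND mu Q.
Proof.
move=> mu0 muU QE.
have w0 s : 0 <= ratr (extreme_weight U mu s) :> R.
  by rewrite ler0q extreme_weight_ge0.
have [P PE] := exists_mixture (extreme U0) w0 (sum_extreme_weight R U mu).
have {}PE f := PE f (measurable_fun_demand f).
exists (fun=> P); split=> [_|A mA].
  rewrite /mean_set/= unlock PE ?extreme_mean// => d; exact: dvalR_ge0.
have mT : measurable [set d : T.-tuple (demand U0) | forall i, A i (tnth d i)].
  exact: measurable_demand_tuple.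
have ind0 (X : Type) (B : set X) x : 0 <= \1_B x :> R by rewrite indicE.
rewrite probability_integral_indic// QE//.
under [RHS]eq_bigr => i _ do rewrite probability_integral_indic// PE//.
rewrite prodEFin bigA_distr_bigA; congr EFin; apply: eq_bigr => s _.
rewrite big_split/=; congr (_ * _); rewrite indicE.
have [dA|/existsNP[i dA]] := pselect (forall i, A i (extreme U0 (s i))).
  rewrite mem_set; last by move=> i /=; rewrite tnth_mktuple; exact: dA.
  by rewrite big1// => i _; rewrite indicE mem_set.
rewrite memNset; last by move=> /(_ i); rewrite tnth_mktuple.
by rewrite (bigD1 i)//= indicE memNset// mul0r.
Qed.

(** The expected cost is affine in [x], with value [b * mu] at [0] and slope
[1 - (b + 1) * mu / U]. *)
Lemma extreme_cost_ge b mu x : 0 <= b -> 0 <= x <= U -> (b + 1) * mu <= U ->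
  b * mu <= \sum_s extreme_weight U mu s * cost b x (dval (extreme U0 s)).
Proof.
move=> b0 /andP[x0 xU] bmu; rewrite big_bool/= /cost/=.
rewrite (max_l (_ : 0 <= U - x)) ?subr_ge0// (max_r (_ : x - U <= 0)) ?subr_le0//.
rewrite sub0r [x - 0]subr0 (max_r (_ : - x <= 0)) ?oppr_le0// (max_l x0).
rewrite mulr0 add0r addr0.
rewrite -subr_ge0 (_ : _ - _ = x * (1 - (b + 1) * mu / U)).
  by rewrite mulr_ge0// subr_ge0 ler_pdivrMr// mul1r.
by field; rewrite gt_eqF.
Qed.

Lemma IND_lower b mu T : 0 <= b -> 0 <= mu -> mu <= U -> (b + 1) * mu <= U ->
  ((T%:R * ratr (b * mu) : R)%:E <= minimax_value b U (@IND R U U0 mu T))%E.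
Proof.
move=> b0 mu0 muU bmu.
have w0 s : 0 <= ratr (extreme_weight U mu s) :> R.
  by rewrite ler0q extreme_weight_ge0.
have pw0 (s : {ffun 'I_T -> bool}) : 0 <= path_weight mu s by exact: prodr_ge0.
have pw1 : \sum_(s : {ffun 'I_T -> bool}) path_weight mu s = 1.
  rewrite -(bigA_distr_bigA (fun (i : 'I_T) s => ratr (extreme_weight U mu s))).
  by rewrite big1// => i _; rewrite sum_extreme_weight.
have [Q QE] := exists_mixture (@extreme_path T) pw0 pw1.
have {}QE f := QE f (measurable_fun_demand_tuple f).
apply: (minimax_value_ge (extreme_paths_in_IND mu0 muU QE)) => x [_ xU].
rewrite QE => [|d]; last by apply: sumr_ge0 => t _; rewrite ler0q cost_ge0.
rewrite lee_fin -subr_ge0.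
pose c (t : 'I_T) s : R :=
  ratr (cost b (x t (prefix_tuple (ltnW (ltn_ord t)) (extreme_path s)))
    (dval (tnth (extreme_path s) t))) - ratr (b * mu).
rewrite (_ : _ - _ = \sum_t \sum_s path_weight mu s * c t s); last first.
  rewrite exchange_big/=.
  under [RHS]eq_bigr => s _ do rewrite -mulr_sumr sumrB sumr_const card_ord mulrBr.
  by rewrite sumrB -mulr_suml pw1 mul1r mulr_natl.
apply: sumr_ge0 => t _.
apply: (@sum_flip_ge0 _ _ t (fun s => ratr (extreme_weight U mu s))) => // s.
(* the order of period t does not see the demand of period t *)
have pre : prefix_tuple (ltnW (ltn_ord t)) (extreme_path (flip t s))
    = prefix_tuple (ltnW (ltn_ord t)) (extreme_path s).
  apply: eq_from_tnth => i; rewrite !tnth_mktuple ffunE.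
  rewrite (_ : _ == t = false)//; apply/negbTE.
  by rewrite -val_eqE/= neq_ltn ltn_ord.
rewrite /c pre !tnth_mktuple ffunE eqxx.
set y := x t _.
have := extreme_cost_ge b0 (xU t _ : 0 <= y <= U) bmu.
rewrite -!rmorphB -!rmorphM -rmorphD ler0q big_bool -subr_ge0.
by congr (0 <= _); rewrite /extreme_weight; case: (s t) => /=; ring.
Qed.

End independent_lower.

(** * The limit *)

Lemma affine_ratio_cvg (R : realType) (a c k : R) (v : nat -> R) :
  0 < a -> 0 < c -> 0 <= k ->
  (forall T, T%:R * c <= v T <= T%:R * c + k) ->
  (fun n => n.+1%:R * a / v n.+1) @ \oo --> a / c.
Proof.
move=> a0 c0 k0 vb.
have cvgd : (fun n => c + k * harmonic n) @ \oo --> c + k * 0.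
  apply: cvgD; first exact: cvg_cst.
  by apply: cvgM; [exact: cvg_cst|exact: cvg_harmonic].
rewrite mulr0 addr0 in cvgd.
have cvgl : (fun n => a * (c + k * harmonic n)^-1) @ \oo --> a / c.
  by apply: cvgM; [exact: cvg_cst|apply: cvgV => //; rewrite gt_eqF].
apply: squeeze_cvgr cvgl (cvg_cst (a / c)); near=> n.
have /andP[lo hi] := vb n.+1.
have N0 : 0 < n.+1%:R :> R by [].
have Nc0 : 0 < n.+1%:R * c by rewrite mulr_gt0.
have v0 : 0 < v n.+1 by exact: lt_le_trans Nc0 lo.
have -> : a * (c + k * harmonic n)^-1 = n.+1%:R * a / (n.+1%:R * c + k).
  rewrite /harmonic/=; move: (n.+1%:R : R) N0 => N N0; field.
  by rewrite !gt_eqF// -[ltLHS]addr0 ltr_leD// mulr_gt0.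
have -> : a / c = n.+1%:R * a / (n.+1%:R * c).
  by move: (n.+1%:R : R) N0 => N N0; field; rewrite !gt_eqF.
have Na0 : 0 <= n.+1%:R * a by rewrite mulr_ge0 ?ltW.
have vk0 : 0 < n.+1%:R * c + k by exact: lt_le_trans hi.
by apply/andP; split; rewrite ler_wpM2l// lef_pV2.
Unshelve. all: by end_near.
Qed.

Theorem mainTheorem8 (R : realType) (U b mu x0 : rat) (U0 : 0 < U)
    (b0 : 0 < b) (mu0 : 0 < mu) (muU : mu <= U)
    (hx0 : x0 = U) (hmu : mu / U < 1 / (b + 1)) :
  (fun T : nat =>
     (minimax_value b x0 (@MAR R U U0 mu T)
      / minimax_value b x0 (@IND R U U0 mu T))%E) @ \oo
    --> (ratr ((U - mu) / (b * mu)) : R)%:E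
  /\ 1 < (U - mu) / (b * mu).
Proof.
have b1 : 0 < b + 1 by rewrite addr_gt0.
have bmu : (b + 1) * mu < U.
  by move: hmu; rewrite ltr_pdivrMr// mulrAC ltr_pdivlMr// mul1r mulrC.
have bmu0 : 0 < b * mu by rewrite mulr_gt0.
split; last by rewrite ltr_pdivlMr// mul1r ltrBrDr -[X in _ + X]mul1r -mulrDl.
pose c : R := ratr (b * mu); pose k : R := ratr (U ^+ 2 / mu).
pose a : R := ratr (U - mu).
have lt_muU : mu < U.
  by apply: le_lt_trans bmu; rewrite mulrDl mul1r lerDr ltW.
have IND_between T : ((T%:R * c)%:E <= minimax_value b U (@IND R U U0 mu T)
    <= (T%:R * c + k)%:E)%E.
  by rewrite IND_lower ?IND_upper// ltW.
have fin_IND T : minimax_value b U (@IND R U U0 mu T) \is a fin_num.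
  have /andP[lo hi] := IND_between T.
  by rewrite fin_numE -ltNye -ltey (lt_le_trans (ltNyr _) lo)
    (le_lt_trans hi (ltry _)).
pose v T := fine (minimax_value b U (@IND R U U0 mu T)).
have vE T : minimax_value b U (@IND R U U0 mu T) = (v T)%:E by rewrite fineK.
have v_between T : T%:R * c <= v T <= T%:R * c + k.
  by have := IND_between T; rewrite vE !lee_fin.
have c0 : 0 < c by rewrite ltr0q.
have MAR_val T : minimax_value b U (@MAR R U U0 mu T) = (T%:R * a)%:E.
  by apply/eqP; rewrite eq_le MAR_upper ?MAR_lower// ltW.
rewrite hx0 -cvg_shiftS.
have -> : ratr ((U - mu) / (b * mu)) = a / c by rewrite fmorph_div.
have ratioE n : (minimax_value b U (@MAR R U U0 mu n.+1)
    / minimax_value b U (@IND R U U0 mu n.+1))%E = (n.+1%:R * a / v n.+1)%:E.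
  have /andP[lo _] := v_between n.+1.
  rewrite MAR_val vE inver gt_eqF ?EFinM//.
  by apply: lt_le_trans lo; rewrite mulr_gt0.
rewrite (_ : (fun _ => _) = fun n => (n.+1%:R * a / v n.+1)%:E); last first.
  by apply/funext => n; exact: ratioE.
apply: cvg_EFin; first exact: nearW.
apply: (affine_ratio_cvg (k := k)) v_between => //.
  by rewrite ltr0q subr_gt0.
by rewrite ler0q divr_ge0 ?exprn_ge0 ?ltW.
Qed.
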